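(* Let $D=\{(\mathbf{s}_i,\mathbf{a}_i,r_i,\mathbf{s}'_i)\}_{i=1}^n$ be a finite dataset with $\mathbf{s}_i,\mathbf{s}'_i\in\mathcal{S}=\mathbb{R}^{d_s}$, $\mathbf{a}_i\in\mathcal{A}=\mathbb{R}^{d_a}$, $r_i\in\mathbb{R}$, let $\pi=\pi_\theta$ be a (stochastic or deterministic) policy, and let $0\le\gamma<1$. Let $\bm{\varepsilon}_\pi(\mathbf{s})\in\mathbb{R}^n$, $\bm{\phi}(\mathbf{s})\in\mathbb{R}^n$ and $\mathbf{r}=[r_1,\dots,r_n]^\intercal$ be the vectors associated with $D$, $\pi$ and the kernels $\psi,\varphi,\phi$. Define the $n\times n$ matrices $\hat{\mathbf{P}}_\pi$ with entries $$\hat{\mathbf{P}}^\pi_{i,j}:=\int_{\mathcal{S}}\phi_i(\mathbf{s}')\,\varepsilon^\pi_j(\mathbf{s}')\,\mathrm{d}\mathbf{s}',\qquad \bm{\Lambda}_\pi:=I-\gamma\hat{\mathbf{P}}_\pi .$$ Then $\hat{\mathbf{P}}_\pi$ is a (row-)stochastic matrix, $\bm{\Lambda}_\pi$ is invertible, and the nonparametric Bellman equation $$\hat V_\pi(\mathbf{s})=\bm{\varepsilon}_\pi^\intercal(\mathbf{s})\left(\mathbf{r}+\gamma\int_{\mathcal{S}}\bm{\phi}(\mathbf{s}')\hat V_\pi(\mathbf{s}')\,\mathrm{d}\mathbf{s}'\right)\qquad\text{for all }\mathbf{s}\in\mathcal{S}$$ has a unique fixed-point solution, namely $$\hat V^*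_\pi(\mathbf{s}):=\bm{\varepsilon}_\pi^\intercal(\mathbf{s})\,\bm{\Lambda}_\pi^{-1}\,\mathbf{r}.$$
   Context: State space $\mathcal{S}=\mathbb{R}^{d_s}$, action space $\mathcal{A}=\mathbb{R}^{d_a}$. The kernels $\psi:\mathcal{S}\times\mathcal{S}\to\mathbb{R}^+$, $\varphi:\mathcal{A}\times\mathcal{A}\to\mathbb{R}^+$, $\phi:\mathcal{S}\times\mathcal{S}\to\mathbb{R}^+$ are positive-valued, symmetric, positive definite (measurable) functions that are normalized, i.e. they integrate to $1$ in each argument (e.g. $\int_{\mathcal{S}}\phi(\mathbf{s},\mathbf{s}')\,\mathrm{d}\mathbf{s}=1$). Write $\psi_i(\mathbf{s})=\psi(\mathbf{s},\mathbf{s}_i)$, $\varphi_i(\mathbf{a})=\varphi(\mathbf{a},\mathbf{a}_i)$, $\phi_i(\mathbf{s})=\phi(\mathbf{s},\mathbf{s}'_i)$, and $\bm{\phi}(\mathbf{s})=[\phi_1(\mathbf{s}),\dots,\phi_n(\mathbf{s})]^\intercal$. A stochastic policy is a conditional probability density $\pi_\theta(\mathbf{a}|\mathbf{s})$ on $\mathcal{A}$; a deterministic policy is a (measurable) map $\pi_\theta:\mathcal{S}\to\mathcal{A}$. The vector $\bm{\varepsilon}_\pi(\mathbf{s})=[\varepsilon^\pi_1(\mathbf{s}),\dots,\varepsilon^\pi_n(\mathbf{s})]^\intercal$ is $$\varepsilon^\pi_i(\mathbf{s})=\begin{cases}\displaystyle\int_{\mathcal{A}}\pi_\theta(\mathbf{a}|\mathbf{s})\frac{\psi_i(\mathbf{s})\varphi_i(\mathbf{a})}{\sum_{j=1}^n\psi_j(\mathbf{s})\varphi_j(\mathbf{a})}\,\mathrm{d}\mathbf{a}&\text{if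 }\pi\text{ is stochastic},\\[2ex]\displaystyle\frac{\psi_i(\mathbf{s})\varphi_i(\pi_\theta(\mathbf{s}))}{\sum_{j=1}^n\psi_j(\mathbf{s})\varphi_j(\pi_\theta(\mathbf{s}))}&\text{if }\pi\text{ is deterministic}.\end{cases}$$ A solution of the nonparametric Bellman equation is a (measurable) function $\hat V_\pi:\mathcal{S}\to\mathbb{R}$ for which the integrals $\int_{\mathcal{S}}\phi_i(\mathbf{s}')\hat V_\pi(\mathbf{s}')\,\mathrm{d}\mathbf{s}'$, $i=1,\dots,n$, exist and are finite and which satisfies the equation at every $\mathbf{s}\in\mathcal{S}$. *)

(* Defs.v *)
From HB Require Import structures.
From mathcomp Require Import all_boot all_order all_algebra.
From mathcomp Require Import all_classical all_reals all_analysis.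

Set Implicit Arguments.
Unset Strict Implicit.
Unset Printing Implicit Defensive.
Import Order.TTheory GRing.Theory Num.Theory.
Import numFieldNormedType.Exports.
Local Open Scope classical_set_scope.
Local Open Scope ring_scope.

(* R^d with its Borel sigma-algebra: the library equips tuples with the
   product sigma-algebra. *)
Notation euclid R d := (d.-tuple (measurableTypeR R)).

(* Lebesgue measure on R^(d+1), from a measure m on R^d: the image of the
   product of the one-dimensional Lebesgue measure and m under
   (x, v) |-> x :: v. *)
Section lebesgue_cons.
Local Open Scope ereal_scope.
Context (R : realType) (d : nat).
Variable m : {sigma_finite_measure set (euclid R d) -> \bar R}.

Definition tcons (p : measurableTypeR R * euclid R d) : euclid R d.+1 :=
  [the d.+1.-tuple (measurableTypeR R) of p.1 :: p.2].

Lemma measurable_tcons : measurable_fun setT tcons.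
Proof. by apply: measurable_cons. Qed.

Definition lebesgue_cons : set (euclid R d.+1) -> \bar R :=
  pushforward (@lebesgue_measure R \x m) tcons.

Let lebesgue_cons0 : lebesgue_cons set0 = 0.
Proof. by rewrite /lebesgue_cons /pushforward preimage_set0 measure0. Qed.

Let lebesgue_cons_ge0 A : 0 <= lebesgue_cons A.
Proof. by rewrite /lebesgue_cons /pushforward; apply: measure_ge0. Qed.

Let lebesgue_cons_sigma_additive : semi_sigma_additive lebesgue_cons.
Proof.
pose mu' : {measure set _ -> \bar R} :=
  measure_function_pushforward__canonical__measure_function_Measure
    (@lebesgue_measure R \x m) measurable_tcons.
exact: (@measure_semi_sigma_additive _ _ _ mu').
Qed.

HB.instance Definition _ := isMeasure.Build _ _ _ lebesgue_cons
  lebesgue_cons0 lebesgue_cons_ge0 lebesgue_cons_sigma_additive.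

Let lebesgue_cons_sigma_finite : sigma_finite setT lebesgue_cons.
Proof.
have /sigma_finiteP[F [TF ndF Foo]] := sigma_finiteT (@lebesgue_measure R).
have /sigma_finiteP[G [TG ndG Goo]] := sigma_finiteT m.
pose g (v : euclid R d.+1) : measurableTypeR R * euclid R d :=
  (thead v, [tuple of behead v]).
have mg : measurable_fun setT g.
  apply: measurable_fun_pair; last exact: measurable_behead.
  exact: measurable_tnth.
have tconsK : g \o tcons = id.
  by apply/funext => -[x v]; congr pair; exact/val_inj.
exists (fun k => g @^-1` (F k `*` G k)).
  apply/seteqP; split => // v _.
  have [k _ Fk] : (\bigcup_k F k) (g v).1 by rewrite -TF.
  have [l _ Gl] : (\bigcup_k G k) (g v).2 by rewrite -TG.
  exists (maxn k l) => //; split.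
    by move: Fk; exact/subsetPset/ndF/leq_maxl.
  by move: Gl; exact/subsetPset/ndG/leq_maxr.
move=> k; have [mF Fk] := Foo k; have [mG Gk] := Goo k; split.
  by rewrite -[X in measurable X]setTI; apply: mg => //; exact: measurableX.
rewrite /lebesgue_cons /pushforward -comp_preimage tconsK preimage_id.
by rewrite product_measure1E// lte_mul_pinfty// ge0_fin_numE.
Qed.

HB.instance Definition _ := Measure_isSigmaFinite.Build _ _ _ lebesgue_cons
  lebesgue_cons_sigma_finite.

End lebesgue_cons.

Fixpoint lebesgue (R : realType) (d : nat) :
    {sigma_finite_measure set (euclid R d) -> \bar R} :=
  if d is d'.+1 return {sigma_finite_measure set (euclid R d) -> \bar R}
  then lebesgue_cons (lebesgue R d')
  else \d_([tuple] : euclid R 0).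

Lemma lebesgue_box (R : realType) (d : nat) (A : 'I_d -> set (measurableTypeR R)) :
  (forall i, measurable (A i)) ->
  lebesgue R d [set v | forall i, A i (tnth v i)] =
  (\prod_(i < d) @lebesgue_measure R (A i))%E.
Proof.
elim: d A => [|d IH] A mA.
  rewrite big_ord0 /= diracE mem_set//.
  by move=> [].
rewrite big_ord_recl /= /lebesgue_cons /pushforward.
rewrite [X in (_ \x _)%E X](_ : _ = A ord0 `*`
    [set v | forall i, A (lift ord0 i) (tnth v i)]); last first.
  apply/seteqP; split => -[x v] /=.
    move=> H; split; first exact: (H ord0).
    by move=> i; have := H (lift ord0 i); rewrite tnthS.
  by move=> [A0 H] i; case: (unliftP ord0 i) => [j ->|->//]; rewrite tnthS.
rewrite product_measure1E//.
  by congr (_ * _)%E; exact: (IH (fun i => A (lift ord0 i))).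
rewrite [X in measurable X](_ : _ = \bigcap_(i in [set: 'I_d])
   ((fun v : euclid R d => tnth v i) @^-1` A (lift ord0 i))).
  apply: fin_bigcap_measurable => // i _.
  by rewrite -[X in measurable X]setTI; exact: measurable_tnth.
by apply/seteqP; split => v /= H i *; exact: H.
Qed.

(* Positive definiteness is meant in the kernel sense (nonnegative quadratic
   forms, points not necessarily distinct), the weaker of the usual readings. *)
Definition positive_definite_kernel (R : realType) (T : Type)
    (k : T -> T -> R) : Prop :=
  forall (m : nat) (x : 'I_m -> T) (c : 'I_m -> R),
    0 <= \sum_(i < m) \sum_(j < m) c i * c j * k (x i) (x j).

Record normalized_kernel (R : realType) (d : nat)
    (k : euclid R d -> euclid R d -> R) : Prop := NormalizedKernel {
  kernel_measurable : measurable_fun setT (fun p => k p.1 p.2);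
  kernel_gt0 : forall x y, 0 < k x y;
  kernel_sym : forall x y, k x y = k y x;
  kernel_posdef : positive_definite_kernel k;
  kernel_int1l : forall y, (\int[lebesgue R d]_x (k x y)%:E = 1)%E;
  kernel_int1r : forall x, (\int[lebesgue R d]_y (k x y)%:E = 1)%E }.

(* [StochasticPolicy p] has conditional density [p s a] of the action a given
   the state s. *)
Inductive policy (R : realType) (ds da : nat) : Type :=
| StochasticPolicy of euclid R ds -> euclid R da -> R
| DeterministicPolicy of euclid R ds -> euclid R da.

Definition is_policy (R : realType) (ds da : nat) (pi : policy R ds da) : Prop :=
  match pi with
  | StochasticPolicy p =>
      [/\ measurable_fun setT (fun sa => p sa.1 sa.2),
          forall s a, 0 <= p s a &
          forall s, (\int[lebesgue R da]_a (p s a)%:E = 1)%E]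
  | DeterministicPolicy f => measurable_fun setT f
  end.

Record transition (R : realType) (ds da : nat) : Type := Transition {
  state : euclid R ds;
  action : euclid R da;
  reward : R;
  next_state : euclid R ds }.

Section nonparametric_bellman.
Context (R : realType) (ds da n : nat).
Variables (psi phi : euclid R ds -> euclid R ds -> R).
Variable varphi : euclid R da -> euclid R da -> R.
Variable D : 'I_n -> transition R ds da.
Variable pi : policy R ds da.
Variable gamma : R.

Definition weight (s : euclid R ds) (a : euclid R da) (i : 'I_n) : R :=
  psi s (state (D i)) * varphi a (action (D i)) /
  \sum_(j < n) psi s (state (D j)) * varphi a (action (D j)).

Definition epsilon (s : euclid R ds) : 'cV[R]_n :=
  \col_i match pi with
         | StochasticPolicy p => \int[lebesgue R da]_a (p s a * weight s a i)
         | DeterministicPolicy f => weight s (f s) i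
         end.

Definition phi_vec (s : euclid R ds) : 'cV[R]_n :=
  \col_i phi s (next_state (D i)).

Definition reward_vec : 'cV[R]_n := \col_i reward (D i).

Definition Phat : 'M[R]_n :=
  \matrix_(i, j) \int[lebesgue R ds]_s (phi_vec s i 0 * epsilon s j 0).

Definition Lambda : 'M[R]_n := 1%:M - gamma *: Phat.

Record bellman_solution (V : euclid R ds -> R) : Prop := BellmanSolution {
  solution_measurable : measurable_fun setT V;
  solution_integrable : forall i,
    (lebesgue R ds).-integrable setT (fun s => (phi_vec s i 0 * V s)%:E);
  solution_eq : forall s, V s =
    ((epsilon s)^T *m
       (reward_vec + gamma *: \col_i \int[lebesgue R ds]_s' (phi_vec s' i 0 * V s')))
    0 0 }.

Definition Vstar (s : euclid R ds) : R :=
  ((epsilon s)^T *m invmx Lambda *m reward_vec) 0 0.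

End nonparametric_bellman.

Definition row_stochastic (R : realType) (n : nat) (P : 'M[R]_n) : Prop :=
  (forall i j, 0 <= P i j) /\ (forall i, \sum_(j < n) P i j = 1).

(* Main.v *)
Require Import Defs.
From mathcomp Require Import all_boot all_order all_algebra.
From mathcomp Require Import all_classical all_reals all_analysis.
From mathcomp Require Import measurable_realfun.

Set Implicit Arguments.
Unset Strict Implicit.
Unset Printing Implicit Defensive.
Import Order.TTheory GRing.Theory Num.Theory.
Local Open Scope ring_scope.

(* V enters the right-hand side of the Bellman equation only through the finite
   vector c_i = \int phi_i V.  A solution therefore has the form
   epsilon^T w with w = r + gamma c; integrating it against phi_i gives
   c = P w, i.e. Lambda w = r.  Since the weights epsilon_j form a partition
   of unity and each phi_i is a probability density, P is row-stochastic, so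
   v = gamma v P forces |v|_1 <= gamma |v|_1, i.e. v = 0 and Lambda is
   invertible. *)

(** * Integration of a partition of unity against a probability density *)

Definition density d (T : measurableType d) (R : realType)
    (mu : {measure set T -> \bar R}) (p : T -> R) : Prop :=
  [/\ measurable_fun setT p, forall x, 0 <= p x & (\int[mu]_x (p x)%:E = 1)%E].

Definition partition_of_unity d (T : measurableType d) (R : realType) (n : nat)
    (f : 'I_n -> T -> R) : Prop :=
  [/\ forall i, measurable_fun setT (f i), forall i x, 0 <= f i x &
      forall x, \sum_(i < n) f i x = 1].

Section integration.
Context d (T : measurableType d) (R : realType) (mu : {measure set T -> \bar R}).

Lemma Rintegral_sum (n : nat) (f : 'I_n -> T -> R) :
  (forall i, mu.-integrable setT (EFin \o f i)) ->
  \int[mu]_x (\sum_(i < n) f i x) = \sum_(i < n) \int[mu]_x f i x.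
Proof.
move=> fi; rewrite /Rintegral.
under eq_integral do rewrite -sumEFin.
rewrite (integral_sum measurableT (f := fun i x => (f i x)%:E))//.
rewrite (eq_bigr (fun i => (fine (\int[mu]_x (f i x)%:E))%:E)).
  by rewrite sumEFin.
by move=> i _; rewrite fineK// integrable_fin_num//; exact: fi.
Qed.

Lemma density_integrable (p : T -> R) :
  density mu p -> mu.-integrable setT (EFin \o p).
Proof.
move=> [mp p0 p1]; apply/integrableP; split; first exact/measurable_EFinP.
under eq_integral do rewrite /= ger0_norm//.
by rewrite p1 ltry.
Qed.

Lemma partition_le1 (n : nat) (f : 'I_n -> T -> R) i x :
  partition_of_unity f -> f i x <= 1.
Proof.
by move=> [_ f0 f1]; rewrite -(f1 x) (bigD1 i)//= lerDl sumr_ge0.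
Qed.

(** Each [f i] lies in [0, 1], so the integrable [p] dominates the product. *)
Lemma integrable_density_partition (p : T -> R) (n : nat)
    (f : 'I_n -> T -> R) i :
  density mu p -> partition_of_unity f ->
  mu.-integrable setT (fun x => (p x * f i x)%:E).
Proof.
move=> dp pf; have [mp p0 _] := dp; have [mf f0 _] := pf.
apply: (le_integrable measurableT _ _ (density_integrable dp)).
  by apply/measurable_EFinP; exact: measurable_funM.
move=> x _ /=; rewrite lee_fin normrM ler_piMr// ger0_norm//.
exact: partition_le1.
Qed.

Lemma Rintegral_density_partition (p : T -> R) (n : nat) (f : 'I_n -> T -> R) :
  density mu p -> partition_of_unity f ->
  \sum_(i < n) \int[mu]_x (p x * f i x) = 1.
Proof.
move=> dp pf; have [_ _ p1] := dp; have [_ _ f1] := pf.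
rewrite -Rintegral_sum; last by move=> i; exact: integrable_density_partition.
by under eq_Rintegral do rewrite -mulr_sumr f1 mulr1; rewrite /Rintegral p1.
Qed.

(** The coefficients [w] may have any sign, so linearity rests on integrability of each term.
    Integrability of the whole is kept in the conclusion because a Bellman solution must have it. *)
Lemma Rintegral_density_comb (p : T -> R) (n : nat) (f : 'I_n -> T -> R)
    (w : 'I_n -> R) : density mu p -> partition_of_unity f ->
  mu.-integrable setT (fun x => (p x * \sum_(i < n) f i x * w i)%:E) /\
  \int[mu]_x (p x * \sum_(i < n) f i x * w i) =
  \sum_(i < n) (\int[mu]_x (p x * f i x)) * w i.
Proof.
move=> dp pf.
have ipf i := integrable_density_partition i dp pf.
have ipfw i : mu.-integrable setT (fun x => (p x * f i x * w i)%:E).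
  by apply: eq_integrable (integrableZr measurableT (w i) (ipf i)).
have E x : p x * \sum_(i < n) f i x * w i = \sum_(i < n) p x * f i x * w i.
  by rewrite mulr_sumr; under eq_bigr do rewrite mulrA.
split.
  have H := @integrable_sum _ _ _ mu _ measurableT _ (index_enum 'I_n) xpredT
    (fun i x => (p x * f i x * w i)%:E) (fun i _ => ipfw i).
  by apply: eq_integrable H => // x _; rewrite E sumEFin.
under eq_Rintegral do rewrite E.
rewrite (Rintegral_sum (f := fun i x => p x * f i x * w i) ipfw).
apply: eq_bigr => i _.
exact: RintegralZr (ipf i).
Qed.

End integration.

(** * Measurability of inverses and parameter integrals; invertibility of the resolvent *)

Lemma measurable_fun_inv d (T : measurableType d) (R : realType) (f : T -> R) :
  (forall x, 0 <= f x) -> measurable_fun setT f ->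
  measurable_fun setT (fun x => (f x)^-1).
Proof.
move=> f0 mf.
rewrite (_ : (fun _ => _) = (fun x => powR x (-1)) \o f); last first.
  by apply/funext => x /=; rewrite powR_inv1.
exact: measurableT_comp (measurable_powR _) mf.
Qed.

(** Tonelli gives measurability of the extended-real integral; [fine] is measurable and sends
    infinite values to 0, so the parameter integrals may diverge. *)
Lemma measurable_fun_Rintegral d1 d2 (T1 : measurableType d1)
    (T2 : measurableType d2) (R : realType)
    (mu : {sigma_finite_measure set T2 -> \bar R}) (f : T1 * T2 -> R) :
  measurable_fun setT f -> (forall z, 0 <= f z) ->
  measurable_fun setT (fun x => \int[mu]_y f (x, y)).
Proof.
move=> mf f0.
have /measurable_EFinP mEf := mf.
have mF := measurable_fun_fubini_tonelli_F (m2 := mu) (EFin \o f) mEf f0.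
exact: measurableT_comp (fine_measurable measurableT) mF.
Qed.

(* If v (1 - gamma P) = 0 then the l1-norm of v is at most gamma times itself. *)
Lemma row_stochastic_resolvent_unit (R : realType) (n : nat) (P : 'M[R]_n)
    (gamma : R) : row_stochastic P -> 0 <= gamma -> gamma < 1 ->
  1%:M - gamma *: P \in unitmx.
Proof.
(* [det0P] provides a row vector in the left kernel: on that side, unit row sums control the
   l1-norm. *)
move=> [P0 P1] g0 g1; rewrite unitmxE unitfE; apply/negP => /det0P[v vn0].
rewrite mulmxBr mulmx1 => /eqP; rewrite subr_eq0 => /eqP vE.
have vj j : `|v 0 j| <= gamma * \sum_(i < n) `|v 0 i| * P i j.
  rewrite {1}vE -scalemxAr mxE normrM ger0_norm// ler_wpM2l// mxE.
  apply: le_trans (ler_norm_sum _ _ _) _; apply: ler_sum => i _.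
  by rewrite normrM (ger0_norm (P0 i j)).
have N0 : \sum_(j < n) `|v 0 j| = 0.
  apply/eqP; rewrite eq_le sumr_ge0// andbT.
  have g1' : 0 < 1 - gamma by rewrite subr_gt0.
  rewrite -(pmulr_rle0 _ g1') mulrBl mul1r subr_le0.
  apply: le_trans (ler_sum _ (fun j _ => vj j)) _.
  (* Exchanging the sums makes the row sums of [P] appear. *)
  rewrite -mulr_sumr exchange_big/= ler_wpM2l//.
  by apply: ler_sum => i _; rewrite -mulr_sumr P1 mulr1.
move: vn0 => /negP; apply; apply/eqP/rowP => j; rewrite mxE.
have /psumr_eq0P := N0 => /(_ (fun _ _ => normr_ge0 _)) /(_ j isT) /eqP.
by rewrite normr_eq0 => /eqP.
Qed.

(** * Row-stochasticity of the transition matrix *)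

Section bellman.
Context (R : realType) (ds da n : nat).
Variables (psi phi : euclid R ds -> euclid R ds -> R).
Variable varphi : euclid R da -> euclid R da -> R.
Variable D : 'I_n -> transition R ds da.
Variable pi : policy R ds da.
Variable gamma : R.
Hypotheses (hpsi : normalized_kernel psi) (hphi : normalized_kernel phi)
  (hvarphi : normalized_kernel varphi) (hpi : is_policy pi).
Hypotheses (hgamma0 : 0 <= gamma) (hgamma1 : gamma < 1).

Let measurable_section d (k : euclid R d -> euclid R d -> R) y :
  normalized_kernel k -> measurable_fun setT (k^~ y).
Proof.
move=> hk; exact: measurableT_comp (kernel_measurable hk) (pair2_measurable y).
Qed.

Lemma phi_density i : density (lebesgue R ds) (fun s => phi_vec phi D s i 0).
Proof.
rewrite (_ : (fun s => _) = phi^~ (next_state (D i))); last first.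
  by apply/funext => s; rewrite mxE.
split; first exact: measurable_section.
- by move=> s; rewrite ltW// kernel_gt0.
- exact: kernel_int1l.
Qed.

Let numer_gt0 s a i : 0 < psi s (state (D i)) * varphi a (action (D i)).
Proof. by rewrite mulr_gt0// kernel_gt0. Qed.

(** The premise ['I_n] encodes n > 0: on an empty dataset the weights would sum to 0. Given an
    index, the denominator is a nonempty sum of positive terms, and dividing by it normalizes the
    weights. *)
Lemma weight_partition : 'I_n ->
  partition_of_unity (fun i sa => weight psi varphi D sa.1 sa.2 i).
Proof.
move=> i0.
have mnum i : measurable_fun setT (fun sa : euclid R ds * euclid R da =>
    psi sa.1 (state (D i)) * varphi sa.2 (action (D i))).
  apply: measurable_funM.
    exact: measurableT_comp (measurable_section (state (D i)) hpsi) measurable_fst.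
  exact: measurableT_comp (measurable_section (action (D i)) hvarphi)
    measurable_snd.
split.
- move=> i; apply: measurable_funM => //; apply: measurable_fun_inv.
    by move=> sa; apply: sumr_ge0 => j _; rewrite ltW.
  exact: measurable_sum.
- move=> i sa; apply: divr_ge0; first by rewrite ltW.
  by apply: sumr_ge0 => j _; rewrite ltW.
- move=> sa; rewrite -mulr_suml divff// gt_eqF// (bigD1 i0)//=.
  by rewrite ltr_pwDl// sumr_ge0// => j _; rewrite ltW.
Qed.

(** For a stochastic policy and fixed [s], the weights are a partition of unity in the action,
    averaged against the density [p s]. For a deterministic one they are merely evaluated along the
    graph of [f]. *)
Lemma epsilon_partition : 'I_n ->
  partition_of_unity (fun i s => epsilon psi varphi D pi s i 0).
Proof.
move=> /weight_partition pw; have [mw w0 w1] := pw.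
rewrite /epsilon; case: pi hpi => [p [mp p0 p1]|f mf].
- have dp s : density (lebesgue R da) (p s).
    by split => //; exact: measurableT_comp mp (pair1_measurable s).
  have pws s : partition_of_unity (fun i a => weight psi varphi D s a i).
    split => [i|i a|a]; last exact: (w1 (s, a)); last exact: (w0 i (s, a)).
    exact: measurableT_comp (mw i) (pair1_measurable s).
  split.
  + move=> i; under eq_fun do rewrite mxE.
    apply: (@measurable_fun_Rintegral _ _ _ _ _ (lebesgue R da)
      (fun sa => p sa.1 sa.2 * weight psi varphi D sa.1 sa.2 i)).
      exact: measurable_funM.
    by move=> sa; rewrite mulr_ge0//; exact: w0.
  + move=> i s; rewrite mxE; apply: Rintegral_ge0 => a _.
    by rewrite mulr_ge0//; exact: (w0 i (s, a)).
  + move=> s; under eq_bigr do rewrite mxE.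
    exact: Rintegral_density_partition.
- split.
  + move=> i; under eq_fun do rewrite mxE.
    have mg := measurable_fun_pair (@measurable_id _ _ setT) mf.
    exact: (measurableT_comp (mw i) mg).
  + by move=> i s; rewrite mxE; exact: (w0 i (s, f s)).
  + by move=> s; under eq_bigr do rewrite mxE; exact: (w1 (s, f s)).
Qed.

(** The averaging argument again, now over states with density phi_i; the row index [i] itself
    witnesses that the dataset is nonempty. *)
Lemma Phat_row_stochastic : row_stochastic (Phat psi phi varphi D pi).
Proof.
split=> [i j|i].
  have [_ p0 _] := phi_density i; have [_ e0 _] := epsilon_partition i.
  by rewrite mxE; apply: Rintegral_ge0 => s _; rewrite mulr_ge0.
under eq_bigr do rewrite mxE.
exact: Rintegral_density_partition (phi_density i) (epsilon_partition i).
Qed.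

Lemma Lambda_unit : Lambda psi phi varphi D pi gamma \in unitmx.
Proof. exact: row_stochastic_resolvent_unit Phat_row_stochastic _ _. Qed.

(** * Existence and uniqueness of the fixed point *)

Let comb (w : 'cV[R]_n) s := ((epsilon psi varphi D pi s)^T *m w) 0 0.

Let combE w s : comb w s = \sum_(i < n) epsilon psi varphi D pi s i 0 * w i 0.
Proof. by rewrite /comb mxE; apply: eq_bigr => i _; rewrite mxE. Qed.

(** Stated for arbitrary [w], this reduces the Bellman operator to linear algebra, for existence as
    well as for uniqueness. *)
Lemma epsilon_comb_integral (w : 'cV[R]_n) i :
  (lebesgue R ds).-integrable setT (fun s => (phi_vec phi D s i 0 * comb w s)%:E) /\
  \int[lebesgue R ds]_s (phi_vec phi D s i 0 * comb w s) =
    (Phat psi phi varphi D pi *m w) i 0.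
Proof.
have [Hi HE] := Rintegral_density_comb (w^~ 0) (phi_density i)
  (epsilon_partition i).
split.
  by apply: eq_integrable Hi => // s _; rewrite combE.
under eq_Rintegral do rewrite combE.
by rewrite HE mxE; apply: eq_bigr => j _; rewrite mxE.
Qed.

Lemma Vstar_solution : bellman_solution psi phi varphi D pi gamma
  (Vstar psi phi varphi D pi gamma).
Proof.
pose w := invmx (Lambda psi phi varphi D pi gamma) *m reward_vec D.
have -> : Vstar psi phi varphi D pi gamma = comb w.
  by apply/funext => s; rewrite /Vstar /comb mulmxA.
split.
- rewrite (_ : comb w = fun s =>
      \sum_(i < n) epsilon psi varphi D pi s i 0 * w i 0); last first.
    by apply/funext => s; exact: combE.
  apply: measurable_sum => i; apply: measurable_funM => //.
  by have [me _ _] := epsilon_partition i; exact: me.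
- by move=> i; have [] := epsilon_comb_integral w i.
- move=> s; rewrite /comb; congr ((_ *m _) 0 0).
  rewrite (_ : \col_i _ = Phat psi phi varphi D pi *m w); last first.
    by apply/colP => i; rewrite mxE; have [] := epsilon_comb_integral w i.
  (* Expanding Lambda turns this into w = r + gamma P w, the equation between coefficient
     vectors. *)
  have : Lambda psi phi varphi D pi gamma *m w = reward_vec D.
    by rewrite /w mulKVmx// Lambda_unit.
  by rewrite {1}/Lambda mulmxBl mul1mx -scalemxAl => <-; rewrite subrK.
Qed.

Lemma bellman_solution_unique (V : euclid R ds -> R) :
  bellman_solution psi phi varphi D pi gamma V ->
  V = Vstar psi phi varphi D pi gamma.
Proof.
move=> [_ _ VE].
set c := \col_i _ in VE.
pose w := reward_vec D + gamma *: c.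
have VwE : V = comb w by apply/funext => s; exact: VE.
(* Inserting the form [comb w] of [V] into the integrals that define [c] closes the loop: [V]
   disappears. *)
have cE : c = Phat psi phi varphi D pi *m w.
  by apply/colP => i; rewrite mxE VwE; have [] := epsilon_comb_integral w i.
have Lw : Lambda psi phi varphi D pi gamma *m w = reward_vec D.
  by rewrite mulmxBl mul1mx -scalemxAl -cE addrK.
apply/funext => s.
(* Replacing r by Lambda w lets the inverse in [Vstar] cancel. *)
by rewrite VwE /Vstar -mulmxA -Lw mulKmx ?Lambda_unit.
Qed.

End bellman.

Theorem theorem1 (R : realType) (ds da n : nat)
    (psi phi : euclid R ds -> euclid R ds -> R)
    (varphi : euclid R da -> euclid R da -> R)
    (D : 'I_n -> transition R ds da) (pi : policy R ds da) (gamma : R)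
    (hpsi : normalized_kernel psi) (hphi : normalized_kernel phi)
    (hvarphi : normalized_kernel varphi) (hpi : is_policy pi)
    (hgamma0 : 0 <= gamma) (hgamma1 : gamma < 1) :
  [/\ row_stochastic (Phat psi phi varphi D pi),
      Lambda psi phi varphi D pi gamma \in unitmx,
      bellman_solution psi phi varphi D pi gamma
        (Vstar psi phi varphi D pi gamma) &
      forall V : euclid R ds -> R,
        bellman_solution psi phi varphi D pi gamma V ->
        V = Vstar psi phi varphi D pi gamma].
Proof.
split.
- exact: Phat_row_stochastic.
- exact: Lambda_unit.
- exact: Vstar_solution.
- by move=> V; exact: bellman_solution_unique.
Qed.
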